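(* Let $R=k[x,y,z]$ with the standard grading, where $k$ is any field, and let $I\subset R_+^2$ be a homogeneous $R_+$-primary grade $3$ Gorenstein ideal. Let $M$ be a skew-symmetric (alternating) matrix over $R$ whose submaximal Pfaffians $\mathrm{Pf}_j(M)$ are homogeneous and generate $I$. If all entries of the $i$th row of $M$ lie in $R_{>1}$, then the ideal $$(\mathrm{Pf}_j(M)\mid j\neq i)+R_+\,\mathrm{Pf}_i(M)$$ is minimally generated by $\mu(I)+2$ elements and defines a ring of type $2$.
   Context: $R_+=(x,y,z)$. $R_{>1}=\bigoplus_{d\geq 2}R_d=R_+^2$ (so $0\in R_{>1}$). $\mathrm{Pf}_j(M)$ is the Pfaffian of the matrix obtained from $M$ by deleting the $j$th row and column. $\mu(-)$ denotes the minimal number of generators. An ideal $J$ ''defines a ring of type $2$'' means that $R/J$ has type $2$, i.e. $\dim_k\operatorname{Soc}(R/J)=2$. *)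

(* Defs.v *)
From mathcomp Require Export all_boot all_order all_algebra.
From mathcomp Require Export mpoly.

Set Implicit Arguments.
Unset Strict Implicit.
Unset Printing Implicit Defensive.

Import GRing.Theory.
Local Open Scope ring_scope.

(* Ideals are Prop-valued predicates, because membership in an ideal of a
   polynomial ring over an arbitrary field need not be a boolean.
   For any predicate S, [ideal_span S] is the ideal generated by S. *)
Section Ideals.
Variable R : comNzRingType.
Implicit Types (I J P S : R -> Prop).

Definition is_ideal I : Prop :=
  [/\ I 0, (forall a b, I a -> I b -> I (a + b))
    & (forall r a, I a -> I (r * a))].

Definition ideal_span S : R -> Prop := fun p =>
  exists n (c f : 'I_n -> R),
    (forall i, S (f i)) /\ p = \sum_(i < n) c i * f i.

Definition same_ideal I J : Prop := forall p, I p <-> J p.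

Definition ideal_le I J : Prop := forall p, I p -> J p.

Definition ideal_add I J : R -> Prop := fun p =>
  exists a b, [/\ I a, J b & p = a + b].

Definition ideal_mul I J : R -> Prop :=
  ideal_span (fun p => exists a b, [/\ I a, J b & p = a * b]).

Definition radical I : R -> Prop := fun p => exists n, I (p ^+ n).

Definition primary_ideal I : Prop :=
  [/\ is_ideal I, ~ I 1
    & forall a b, I (a * b) -> I a \/ radical I b].

Definition primary_to P I : Prop :=
  primary_ideal I /\ same_ideal (radical I) P.

(* [mu_is I m]: m is the minimal number of generators of I. *)
Definition generated_by n (f : 'I_n -> R) : R -> Prop :=
  ideal_span (fun p => exists j, p = f j).

Definition mu_is I (m : nat) : Prop :=
  (exists f : 'I_m -> R, same_ideal I (generated_by f)) /\
  (forall n (f : 'I_n -> R), same_ideal I (generated_by f) -> (m <= n)%N).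

Definition span_seq (s : seq R) : R -> Prop := ideal_span (fun p => p \in s).

Definition regular_seq (s : seq R) : Prop :=
  (forall i, (i < size s)%N -> forall p,
     span_seq (take i s) (s`_i * p) -> span_seq (take i s) p) /\
  ~ span_seq s 1.

Definition grade_is I (g : nat) : Prop :=
  (exists s, [/\ size s = g, (forall a, a \in s -> I a) & regular_seq s]) /\
  (forall s, (forall a, a \in s -> I a) -> regular_seq s -> (size s <= g)%N).

End Ideals.

Section Pfaffians.
Variable R : comNzRingType.

Definition alternating n (M : 'M[R]_n) : Prop :=
  M^T = - M /\ forall i, M i i = 0.

(* Expansion along the first row:
     Pf A = \sum_(j >= 1) (-1)^(j-1) A_0j Pf (A without rows/columns 0 and j),
   where the column index j is written [lift ord0 j'] with j' = j - 1.  The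
   Pfaffian of the empty matrix is 1, and that of any matrix of odd size is 0. *)
Fixpoint Pf n : 'M[R]_n -> R :=
  match n with
  | 0 => fun _ => 1
  | n'.+1 => fun A =>
      \sum_(j < n') (-1) ^+ j * A ord0 (lift ord0 j)
        * Pf (row' j (col' j (row' ord0 (col' ord0 A))))
  end.

Definition subPf n (M : 'M[R]_n) (j : 'I_n) : R := Pf (row' j (col' j M)).

End Pfaffians.

Section GradedPolynomialRing.
Variable k : fieldType.
Notation R := {mpoly k[3]}.
Implicit Types (I : R -> Prop).

Definition Rplus : R -> Prop := generated_by (fun j : 'I_3 => 'X_j : R).

(* R_{>1}, the sum of the R_d with d >= 2. *)
Definition Rgt1 : R -> Prop := fun p =>
  forall m, m \in msupp p -> (1 < mdeg m)%N.

Definition homogeneous_ideal I : Prop :=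
  forall p d, I p -> I (pihomog mdeg d p).

(* The preimage in R of Soc (R/I), the annihilator of R_+ in R/I. *)
Definition socle I : R -> Prop := fun p => forall a, Rplus a -> I (a * p).

(* R/I has type t, for I primary to R_+: the classes of b_0, ..., b_(t-1) form
   a k-basis of Soc (R/I). *)
Definition type_is I (t : nat) : Prop :=
  exists b : 'I_t -> R,
    [/\ forall i, socle I (b i),
        forall c : 'I_t -> k, I (\sum_(i < t) c i *: b i) -> forall i, c i = 0
      & forall p, socle I p ->
          exists c : 'I_t -> k, I (p - \sum_(i < t) c i *: b i)].

(* For I primary to R_+, R/I is Artinian, hence Cohen-Macaulay, and it is
   Gorenstein exactly when its type is 1. *)
Definition gorenstein_ideal I : Prop := type_is I 1.

(* (Pf_j(M) | j != i) + R_+ Pf_i(M) *)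
Definition trimmed_ideal n (M : 'M[R]_n) (i : 'I_n) : R -> Prop :=
  ideal_add (ideal_span (fun p => exists2 j, j != i & p = subPf M j))
            (ideal_mul Rplus (ideal_span (fun p => p = subPf M i))).

End GradedPolynomialRing.

Arguments Rplus : clear implicits.

(* Main.v *)
Require Import Defs.
From mathcomp Require Import ring.
From Stdlib Require Import Classical.
Local Open Scope ring_scope.

(* Write F_j = Pf_j(M).  The Buchsbaum-Eisenbud complex
   0 -> R -> R^n -> R^n -> R given by M and the signed Pfaffians is exact,
   because I contains a regular sequence of length 3 and annihilates the
   homology; hence every syzygy of the F_j is (up to signs) a combination of the
   rows of M, and its i-th entry lies in R_+^2 by the assumption on the i-th row.
   Everything follows from this.  F_i is a minimal generator of I; if S is a
   minimal generating set of F_j's, then i is in S, and the F_j with j in S other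
   than i together with x F_i, y F_i, z F_i minimally generate the trimmed ideal
   J.  If s spans the socle of R/I, the Koszul relations between x s, y s and z s
   show that F_i occurs in them only with coefficients in R_+, so that R_+ s lies
   in J and the socle of R/J is spanned by F_i and s. *)

Import GRing.Theory.
Set Implicit Arguments.
Unset Strict Implicit.
Unset Printing Implicit Defensive.

(** * Pfaffians of alternating matrices *)

Section ListPfaffian.
Variables (R : comNzRingType) (T : eqType).
Implicit Types (v w : T -> R) (F G : seq T -> R) (s t : seq T).

(* If [F] is an alternating function of its list of arguments, [contract v F] is
   the exterior product of [v] and [F]:
     s |-> \sum_j (-1)^j v(s_j) F(s without s_j). *)
Fixpoint contract v F s : R :=
  if s is y :: t then v y * F t - contract v (fun u => F (y :: u)) t else 0.

Lemma eq_contract v F G s :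
  (forall t, (size t).+1 = size s -> F t = G t) -> contract v F s = contract v G s.
Proof.
elim: s F G => //= y s IHs F G eqFG; rewrite eqFG //; congr (_ - _).
by apply: IHs => t st; apply: eqFG; rewrite /= st.
Qed.

Lemma contract_opp v F s : contract v (fun t => - F t) s = - contract v F s.
Proof.
elim: s F => [|y s IHs] F /=; first by rewrite oppr0.
by rewrite IHs opprB mulrN opprK addrC.
Qed.

Lemma contractB v F G s :
  contract v (fun t => F t - G t) s = contract v F s - contract v G s.
Proof.
elim: s F G => [|y s IHs] F G /=; first by rewrite subr0.
by rewrite IHs; ring.
Qed.

Lemma contractZ v c F s : contract v (fun t => c * F t) s = c * contract v F s.
Proof.
elim: s F => [|y s IHs] F /=; first by rewrite mulr0.
by rewrite IHs; ring.
Qed.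

Lemma contract0 v s : contract v (fun=> 0) s = 0.
Proof. by elim: s => //= y s ->; rewrite mulr0 subr0. Qed.

Lemma contract_anticomm v w F s :
  contract v (contract w F) s = - contract w (contract v F) s.
Proof.
elim: s F => [|y s IHs] F /=; first by rewrite oppr0.
by rewrite !contractB !contractZ IHs; ring.
Qed.

(** Anticommutation gives only twice this identity, which says nothing in characteristic 2; hence a
    separate induction. *)
Lemma contract_sq v F s : contract v (contract v F) s = 0.
Proof.
elim: s F => //= y s IHs F.
by rewrite contractB contractZ IHs; ring.
Qed.

(** Adjacent exchanges generate all permutations; the second clause does not follow from the first
    in characteristic 2. *)
Definition alternates F : Prop :=
  (forall s x y t, F (s ++ x :: y :: t) = - F (s ++ y :: x :: t)) /\
  (forall s x t, F (s ++ x :: x :: t) = 0).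

Lemma alternates_cons F x : alternates F -> alternates (fun s => F (x :: s)).
Proof.
by case=> swF sqF; split=> s; [apply: (swF (x :: s)) | apply: (sqF (x :: s))].
Qed.

Lemma alternates_contract v F : alternates F -> alternates (contract v F).
Proof.
move=> altF; split=> s.
  move=> x y t; elim: s F altF => [|z s IHs] F altF /=; last first.
    by rewrite (IHs _ (alternates_cons z altF)) altF.1; ring.
  rewrite (@eq_contract v _ (fun u => - F [:: y, x & u])) ?contract_opp.
    by ring.
  by move=> u _; apply: (altF.1 [::]).
move=> x t; elim: s F altF => [|z s IHs] F altF /=; last first.
  by rewrite (IHs _ (alternates_cons z altF)) altF.2; ring.
rewrite (@eq_contract v _ (fun=> 0)) ?contract0; first by ring.
by move=> u _; apply: (altF.2 [::]).
Qed.

Lemma alternates_move F s x t :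
  alternates F -> F (s ++ x :: t) = (-1) ^+ size s * F (x :: s ++ t).
Proof.
elim: s F => [|y s IHs] F altF /=; first by rewrite mul1r.
rewrite (IHs _ (alternates_cons y altF)) (altF.1 [::]) exprS /=; ring.
Qed.

Lemma alternates_mem F s x : alternates F -> x \in s -> F (x :: s) = 0.
Proof.
move=> altF /splitPr [s1 s2].
have := @alternates_move _ s1 x s2 (alternates_cons x altF).
by rewrite /= => ->; rewrite (altF.2 [::] x (s1 ++ s2)) mulr0.
Qed.

Variable a : T -> T -> R.
Hypothesis aC : forall x y, a x y = - a y x.
Hypothesis a0 : forall x, a x x = 0.

(* The Pfaffian of the matrix (a s_i s_j); [n] is fuel, sufficient as soon as
   [size s <= n]. *)
Fixpoint lpf_rec n s : R :=
  match n, s with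
  | 0, _ => (nilp s)%:R
  | n'.+1, [::] => 1
  | n'.+1, x :: t => contract (a x) (lpf_rec n') t
  end.

Definition lpf s := lpf_rec (size s) s.

Lemma lpf_recE n s : (size s <= n)%N -> lpf_rec n s = lpf s.
Proof.
rewrite /lpf; move: (leqnn (size s)); move: {2 4}(size s) => m.
elim: n m s => [|n IHn] [|m] [|x s] //=; rewrite !ltnS => le_sm le_sn.
by apply: eq_contract => t st; apply: IHn; apply: ltnW; rewrite st.
Qed.

Lemma lpf_cons x s : lpf (x :: s) = contract (a x) lpf s.
Proof. by apply: eq_contract => t st; apply: lpf_recE; apply: ltnW; rewrite st. Qed.

(** An exchange of the first two arguments shows after expanding twice, where exterior products by
    two rows anticommute; exchanges further right come from [alternates_contract]. Hence two base
    cases, fuel 0 and 1. *)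
Lemma alternates_lpf_rec n : alternates (lpf_rec n).
Proof.
have step m : alternates (lpf_rec m) ->
    (forall x y t, lpf_rec m.+1 [:: x, y & t] = - lpf_rec m.+1 [:: y, x & t]) ->
    (forall x t, lpf_rec m.+1 [:: x, x & t] = 0) -> alternates (lpf_rec m.+1).
  move=> altm sw sq; split=> [[|z s]|[|z s]] //= *.
    exact: (alternates_contract _ altm).1.
  exact: (alternates_contract _ altm).2.
suff: alternates (lpf_rec n) /\ alternates (lpf_rec n.+1) by case.
elim: n => [|n [IHn IHn1]]; split=> //.
- by split=> [[|z s]|[|z s]] //= *; rewrite oppr0.
- apply: step => /=.
  + by split=> [[|z s]|[|z s]] //= *; rewrite oppr0.
  + move=> x y t; rewrite !(@eq_contract _ _ (fun=> 0)) ?contract0 //.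
    by rewrite aC; ring.
  + move=> x t; rewrite !(@eq_contract _ _ (fun=> 0)) ?contract0 //.
    by rewrite a0; ring.
apply: step => //= [x y t|x t].
  by rewrite aC contract_anticomm; ring.
by rewrite a0 contract_sq; ring.
Qed.

Lemma alternates_lpf : alternates lpf.
Proof.
split=> [s x y t|s x t].
  rewrite -!(@lpf_recE (size s + (size t).+2)) ?size_cat //.
  exact: (alternates_lpf_rec _).1.
by rewrite /lpf (alternates_lpf_rec _).2.
Qed.

Definition omit j s := take j s ++ drop j.+1 s.

Lemma size_omit j s : (j < size s)%N -> size (omit j s) = (size s).-1.
Proof.
move=> lt_js; rewrite size_cat size_drop size_takel; last exact: ltnW.
by case: (size s) lt_js => //= m; rewrite ltnS subSS => /subnKC.
Qed.

Lemma nth_omit x0 j s (t : nat) :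
  (j < size s)%N -> nth x0 (omit j s) t = nth x0 s (bump j t).
Proof.
move=> lt_js; rewrite nth_cat size_takel; last exact: ltnW.
rewrite /bump; case: (ltnP t j) => [lt_tj|le_jt].
  by rewrite nth_take.
by rewrite nth_drop addSn subnKC.
Qed.

Lemma contractE x0 v F s :
  contract v F s =
    \sum_(j < size s) (-1) ^+ j * (v (nth x0 s j) * F (omit j s)).
Proof.
elim: s F => [|y s IHs] F /=; first by rewrite big_ord0.
rewrite big_ord_recl /omit /= mul1r drop0 IHs -sumrN; congr (_ + _).
by apply: eq_bigr => j _; rewrite /bump leq0n add1n exprS mulN1r mulNr.
Qed.

(** Deleting row and column [j] of the remaining matrix is omitting the [j]-th index. The induction
    is strong because the size drops by two. *)
Lemma Pf_lpf n (A : 'M[R]_n) x0 s :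
  size s = n -> (forall i j, A i j = a (nth x0 s i) (nth x0 s j)) ->
  Pf A = lpf s.
Proof.
have [m] := ubnP n; elim: m => // m IHm in n A s *; rewrite ltnS => le_nm.
case: n le_nm A => [|n] le_nm A; case: s => [|x s] //= [sz_s] A_E.
rewrite lpf_cons (contractE x0) sz_s; apply: eq_bigr => j _.
rewrite A_E lift0 /= mulrA; congr (_ * _).
have lt_js : (j < size s)%N by rewrite sz_s.
apply: IHm => [||i l]; first exact: leq_ltn_trans (leq_pred _) le_nm.
  by rewrite size_omit ?sz_s.
by rewrite !mxE A_E !lift0 /= !nth_omit.
Qed.

End ListPfaffian.

Lemma contract_linear (R : comNzRingType) (T : finType) (v : T -> R) F s :
  contract v F s = \sum_t v t * contract (fun u => (u == t)%:R) F s.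
Proof.
elim: s F => [|y s IHs] F /=; first by rewrite big1 // => t _; rewrite mulr0.
rewrite IHs [in RHS](bigD1 y) //= eqxx [X in _ = _ + X](eq_bigr
  (fun t => - (v t * contract (fun u => (u == t)%:R) (fun u => F (y :: u)) s))).
  by rewrite sumrN [in LHS](bigD1 y) //= opprD addrA mul1r mulrBr.
by move=> t; rewrite eq_sym => /negPf ->; rewrite mul0r sub0r mulrN.
Qed.

(** * Submaximal Pfaffians: the kernel vector and an adjugate *)

Section SubmaximalPfaffians.
Variables (R : comNzRingType) (n : nat) (M : 'M[R]_n).
Hypothesis altM : alternating M.

Let aC x y : M x y = - M y x.
Proof. by have /matrixP/(_ y x) := altM.1; rewrite !mxE. Qed.

Let a0 x : M x x = 0. Proof. exact: altM.2. Qed.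

Let altPf := alternates_lpf aC a0.

Lemma subPfE j : subPf M j = lpf M (omit j (enum 'I_n)).
Proof.
apply: (@Pf_lpf _ _ M _ _ j) => [|i l].
  by rewrite size_omit size_enum_ord.
rewrite !mxE !nth_omit ?size_enum_ord //; congr (M _ _); apply/val_inj;
  by rewrite /= nth_enum_ord // -[bump _ _]/(val (lift j _)) ltn_ord.
Qed.

Definition signedPf : 'cV[R]_n := \col_j ((-1) ^+ j * subPf M j).

(** Entry [x] is the first-row expansion of the Pfaffian of the index list with [x] prepended, which
    vanishes because [x] occurs twice. *)
Lemma mul_signedPf : M *m signedPf = 0.
Proof.
apply/colP=> x; rewrite !mxE.
have := alternates_mem altPf (mem_enum 'I_n x).
rewrite lpf_cons (contractE x) size_enum_ord; apply: etrans.
apply: eq_bigr => j _.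
by rewrite !mxE subPfE nth_ord_enum; ring.
Qed.

(* Column [l] of [N] is, up to sign, the expansion of the Pfaffian of [M]
   without [j] along its row [l]; hence rows [x] other than [j] of [M *m N] are
   those of [subPf M j] times the identity.  Row [j] is left unspecified, as it is
   determined by [signedPf^T *m M = 0]. *)
Lemma Pf_adjugate j :
  exists N : 'M[R]_n,
    forall x l, x != j -> (M *m N) x l = (x == l)%:R * subPf M j.
Proof.
pose s := omit j (enum 'I_n); pose q l := index l s.
exists (\matrix_(t, l) if l == j then 0 else
          (-1) ^+ q l * contract (fun u => (u == t)%:R) (lpf M) (omit (q l) s)).
have mem_s x : x != j -> x \in s.
  move=> neq_xj; have: x \in take j (enum 'I_n) ++ j :: drop j.+1 (enum 'I_n).
    rewrite -{2}(nth_ord_enum j j) -drop_nth ?size_enum_ord //.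
    by rewrite cat_take_drop mem_enum.
  by rewrite /s mem_cat inE (negPf neq_xj) -mem_cat.
move=> x l neq_xj; rewrite mxE; have [->|neq_lj] := eqVneq l j.
  by rewrite (negPf neq_xj) mul0r big1 // => t _; rewrite mxE eqxx mulr0.
have s_l := mem_s l neq_lj.
have s_E : s = take (q l) s ++ l :: drop (q l).+1 s.
  rewrite -{2}(nth_index l s_l) -drop_nth ?index_mem //.
  by rewrite cat_take_drop.
have size_q : size (take (q l) s) = q l by rewrite size_takel // index_size.
(* Entry [(x, l)] is the Pfaffian of [s] with [l] replaced by [x]; the sign moves [x] to the front.
   If [x != l], the index [x] is repeated. *)
transitivity (lpf M (take (q l) s ++ x :: drop (q l).+1 s)).
  rewrite alternates_move // lpf_cons contract_linear size_q mulr_sumr.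
  by apply: eq_bigr => t _; rewrite mxE (negPf neq_lj) mulrCA.
have [->|neq_xl] := eqVneq x l; first by rewrite mul1r subPfE -s_E.
rewrite mul0r alternates_move // alternates_mem ?mulr0 //.
by have := mem_s x neq_xj; rewrite {1}s_E !mem_cat inE (negPf neq_xl).
Qed.

End SubmaximalPfaffians.

(** * Exactness of the Buchsbaum-Eisenbud complex *)

Section IdealSpan.
Variable R : comNzRingType.
Implicit Types (J S : R -> Prop).

Lemma ideal_sum J (T : finType) (P : pred T) (c f : T -> R) :
  is_ideal J -> (forall t, P t -> J (f t)) -> J (\sum_(t | P t) c t * f t).
Proof. by case=> J0 JD JM Jf; apply: big_ind => // t Pt; apply/JM/Jf. Qed.

Lemma ideal_span_min J S :
  is_ideal J -> (forall p, S p -> J p) -> forall p, ideal_span S p -> J p.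
Proof.
by move=> J_id SJ p [n [c [f [Sf ->]]]]; apply: ideal_sum => // t _; apply: SJ.
Qed.

Lemma mem_ideal_span S p : S p -> ideal_span S p.
Proof. by exists 1%N, (fun=> 1), (fun=> p); rewrite big_ord1 mul1r. Qed.

Lemma ideal_span_ideal S : is_ideal (ideal_span S).
Proof.
split=> [|p q [m [c [f [Sf ->]]]] [n [d [g [Sg ->]]]]|r p [m [c [f [Sf ->]]]]].
- by exists 0%N, (fun=> 0), (fun=> 0); split=> [[]|] //; rewrite big_ord0.
- exists (m + n)%N, (fun t => match split t with inl u => c u | inr u => d u end),
    (fun t => match split t with inl u => f u | inr u => g u end).
  split=> [t|]; first by case: (split t).
  rewrite big_split_ord /=; congr (_ + _); apply: eq_bigr => u _.
    by rewrite (unsplitK (inl u)).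
  by rewrite (unsplitK (inr u)).
by exists m, (fun t => r * c t), f; split=> //; rewrite mulr_sumr;
  apply: eq_bigr => t _; rewrite mulrA.
Qed.

Definition comb (T : finType) (A : {set T}) (f : T -> R) p : Prop :=
  exists c : T -> R, p = \sum_(t in A) c t * f t.

Lemma comb_ideal (T : finType) (A : {set T}) (f : T -> R) : is_ideal (comb A f).
Proof.
split=> [|_ _ [c ->] [d ->]|r _ [c ->]].
- by exists (fun=> 0); rewrite big1 // => t _; rewrite mul0r.
- exists (fun t => c t + d t); rewrite -big_split /=.
  by apply: eq_bigr => t _; rewrite mulrDl.
- exists (fun t => r * c t); rewrite mulr_sumr.
  by apply: eq_bigr => t _; rewrite mulrA.
Qed.

Lemma mem_comb (T : finType) (A : {set T}) (f : T -> R) t :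
  t \in A -> comb A f (f t).
Proof.
move=> At; exists (fun u => (u == t)%:R); rewrite (bigD1 t) //= eqxx mul1r.
by rewrite big1 ?addr0 // => u /andP[_ /negPf->]; rewrite mul0r.
Qed.

Lemma generated_byP n (f : 'I_n -> R) p :
  generated_by f p <-> exists c : 'I_n -> R, p = \sum_j c j * f j.
Proof.
split=> [gen_p|[c ->]]; last first.
  by exists n, c, f; split=> // j; exists j.
have [c ->] : comb setT f p.
  apply: (ideal_span_min (comb_ideal _ _)) gen_p => _ [j ->].
  by apply: mem_comb; rewrite inE.
by exists c; apply: eq_bigl => j; rewrite inE.
Qed.

Lemma span_seqP (s : seq R) p :
  span_seq s p <-> exists c : 'I_(size s) -> R, p = \sum_j c j * s`_j.
Proof.
apply: (iff_trans _ (generated_byP _ _)).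
split; apply: (ideal_span_min (ideal_span_ideal _)) => q.
  move=> /(nthP 0)[j lt_js <-].
  by apply: mem_ideal_span; exists (Ordinal lt_js).
by move=> [j ->]; apply: mem_ideal_span; apply: mem_nth.
Qed.

End IdealSpan.

Section BuchsbaumEisenbud.
Variables (R : idomainType) (n : nat) (M : 'M[R]_n).
Hypothesis altM : alternating M.
Local Notation p := (signedPf M).

Lemma trmx_mul_alternating (b : 'cV[R]_n) : M *m b = 0 -> b^T *m M = 0.
Proof.
move=> Mb0; apply: trmx_inj; rewrite trmx_mul trmxK altM.1 mulNmx Mb0.
by rewrite oppr0 trmx0.
Qed.

(** Multiplying [b^T *m M = 0] by the adjugate [N] expresses [subPf M j * b_l] through [b_j] and
    [(M *m N) j l]. The same holds for [p]; eliminating the unspecified entry makes [b] proportional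
    to [p]. *)
Lemma subPf_ker (b : 'cV[R]_n) j :
  M *m b = 0 -> exists c, subPf M j *: b = c *: p.
Proof.
move=> Mb0; have [Pf0|Pf_neq0] := eqVneq (subPf M j) 0.
  by exists 0; rewrite Pf0 !scale0r.
have [N MN] := Pf_adjugate altM j.
have ker_row (u : 'cV[R]_n) l : l != j -> M *m u = 0 ->
    u l 0 * subPf M j = - (u j 0 * (M *m N) j l).
  move=> neq_lj /trmx_mul_alternating Mu0.
  have /rowP/(_ l): u^T *m (M *m N) = 0 by rewrite mulmxA Mu0 mul0mx.
  rewrite mxE [RHS]mxE (bigD1 j) //= (bigD1 l) //= big1 => [|x /andP[nxj nxl]].
    rewrite addr0 (MN l l) // eqxx mul1r ![u^T _ _]mxE => /eqP.
    by rewrite addrC addr_eq0 => /eqP.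
  by rewrite MN // (negPf nxl) mul0r mulr0.
exists ((-1) ^+ j * b j 0); apply/colP=> l; rewrite !mxE.
have [->|neq_lj] := eqVneq l j.
  by rewrite mulrACA -expr2 sqrr_sign mul1r mulrC.
apply: (mulfI Pf_neq0).
have := ker_row b l neq_lj Mb0.
have := ker_row p l neq_lj (mul_signedPf altM); rewrite !mxE => p_l b_l.
transitivity (b j 0 * ((-1) ^+ j * (((-1) ^+ l * subPf M l) * subPf M j)));
  last by ring.
rewrite p_l [subPf M j * _]mulrC b_l.
suff: (-1) ^+ j * (-1) ^+ j = 1 :> R by move=> s; ring: s.
by rewrite -expr2 sqrr_sign.
Qed.

(** [N *m a] works in every row but [j]. As [p] is orthogonal to both [a] and [M *m N *m a], row [j]
    follows after cancelling [p_j]. *)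
Lemma subPf_coker (a : 'cV[R]_n) j :
  p^T *m a = 0 -> exists b, subPf M j *: a = M *m b.
Proof.
move=> pa0; have [Pf0|Pf_neq0] := eqVneq (subPf M j) 0.
  by exists 0; rewrite Pf0 scale0r mulmx0.
have [N MN] := Pf_adjugate altM j.
exists (N *m a); rewrite mulmxA.
have off x : x != j -> (M *m N *m a) x 0 = subPf M j * a x 0.
  move=> neq_xj; rewrite mxE (bigD1 x) //= big1 => [|l]; last first.
    by rewrite MN // eq_sym => /negPf->; rewrite !mul0r.
  by rewrite MN // eqxx mul1r addr0.
apply/colP=> x; rewrite mxE; have [->{x}|/off->//] := eqVneq x j.
have p_neq0 : p j 0 != 0 by rewrite mxE mulf_neq0 // signr_eq0.
apply: (mulfI p_neq0); apply/eqP; rewrite -subr_eq0; apply/eqP.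
have dot (u : 'cV[R]_n) : p^T *m u = 0 -> \sum_x p x 0 * u x 0 = 0.
  move=> /matrixP/(_ 0 0); rewrite !mxE => pu; rewrite -[RHS]pu.
  by apply: eq_bigr => x _; rewrite [p^T _ _]mxE.
have {}pa0 := dot a pa0.
have pMNa : p^T *m (M *m N *m a) = 0.
  by rewrite !mulmxA (trmx_mul_alternating (mul_signedPf altM)) !mul0mx.
have := dot _ pMNa; rewrite (bigD1 j) //= (eq_bigr (fun x =>
  subPf M j * (p x 0 * a x 0))) => [|x /off ->]; last by ring.
move: pa0; rewrite (bigD1 j) //= -mulr_sumr => /eqP.
rewrite addr_eq0 => /eqP pa /eqP; rewrite addr_eq0 => /eqP ->.
by rewrite mulrCA pa; ring.
Qed.

Lemma Pf_ideal_annihilates_ker f (b : 'cV[R]_n) :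
  generated_by (subPf M) f -> M *m b = 0 -> exists c, f *: b = c *: p.
Proof.
move=> /generated_byP[e ->] Mb0.
have /fin_all_exists[c c_E] j := subPf_ker j Mb0.
exists (\sum_j e j * c j); rewrite !scaler_suml; apply: eq_bigr => j _.
by rewrite -!scalerA c_E.
Qed.

Lemma Pf_ideal_annihilates_syz f (a : 'cV[R]_n) :
  generated_by (subPf M) f -> p^T *m a = 0 -> exists b, f *: a = M *m b.
Proof.
move=> /generated_byP[e ->] pa0.
have /fin_all_exists[c c_E] j := subPf_coker j pa0.
exists (\sum_j e j *: c j); rewrite scaler_suml mulmx_sumr; apply: eq_bigr => j _.
by rewrite -scalemxAr -c_E scalerA.
Qed.

Variables f1 f2 f3 : R.
Hypothesis f1_I : generated_by (subPf M) f1.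
Hypothesis f2_I : generated_by (subPf M) f2.
Hypothesis f3_I : generated_by (subPf M) f3.
Hypothesis f1_reg : forall q, f1 * q = 0 -> q = 0.
Hypothesis f2_reg : forall q r, f2 * q = r * f1 -> exists u, q = u * f1.
Hypothesis f3_reg :
  forall q r s, f3 * q = r * f1 + s * f2 -> exists u v, q = u * f1 + v * f2.

Let f1_scale_inj m (u v : 'cV[R]_m) : f1 *: u = f1 *: v -> u = v.
Proof.
move=> /colP uv; apply/colP=> x; apply/eqP; rewrite -subr_eq0; apply/eqP.
by apply: f1_reg; have := uv x; rewrite !mxE mulrBr => ->; rewrite subrr.
Qed.

Let f2_scale_dvd m (u v : 'cV[R]_m) : f2 *: u = f1 *: v -> exists w, u = f1 *: w.
Proof.
move=> /colP uv; have [|w w_E] := @fin_all_exists _ _ (fun x w => u x 0 = w * f1).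
  move=> x; apply: (@f2_reg _ (v x 0)); have := uv x.
  by rewrite !mxE mulrC => ->; ring.
by exists (\col_x w x); apply/colP=> x; rewrite !mxE w_E mulrC.
Qed.

Let p_faithful c : c *: p = 0 -> c = 0.
Proof.
move=> cp0; apply: f1_reg; have /generated_byP[e ->] := f1_I.
rewrite mulr_suml big1 // => j _; have /colP/(_ j) := cp0; rewrite !mxE => cPf.
have: (-1) ^+ j * (c * ((-1) ^+ j * subPf M j)) = 0 by rewrite cPf mulr0.
rewrite [(-1) ^+ j * _](_ : _ = (-1) ^+ (2 * j) * (c * subPf M j)); last first.
  by rewrite mul2n -addnn exprD; ring.
by rewrite mulnC exprM sqrr_sign mul1r -mulrA [_ * c]mulrC => ->; rewrite mulr0.
Qed.

(** From [f1 *: b = c1 *: p] and [f2 *: b = c2 *: p] follows [f2 * c1 = c2 * f1]; so [f1] divides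
    [c1] and can be cancelled. *)
Lemma ker_alternating (b : 'cV[R]_n) : M *m b = 0 -> exists c, b = c *: p.
Proof.
move=> Mb0.
have [c1 f1b] := Pf_ideal_annihilates_ker f1_I Mb0.
have [c2 f2b] := Pf_ideal_annihilates_ker f2_I Mb0.
have /eqP : (f2 * c1 - c2 * f1) *: p = 0.
  by rewrite scalerBl -scalerA -f1b mulrC -scalerA -f2b !scalerA mulrC subrr.
move=> /eqP/p_faithful/eqP; rewrite subr_eq0 => /eqP/f2_reg[c c1_E].
by exists c; apply: f1_scale_inj; rewrite f1b c1_E mulrC scalerA.
Qed.

Lemma syzygy_signedPf (a : 'cV[R]_n) : p^T *m a = 0 -> exists b, a = M *m b.
Proof.
move=> pa0.
have [b1 f1a] := Pf_ideal_annihilates_syz f1_I pa0.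
have [b2 f2a] := Pf_ideal_annihilates_syz f2_I pa0.
have [b3 f3a] := Pf_ideal_annihilates_syz f3_I pa0.
(* Koszul relations on [f1, f2, f3]: once [f1 *: b2 - f2 *: b1] is corrected to
   [0], [b1] is divisible by [f1]. *)
have kos f g (b c : 'cV[R]_n) : f *: a = M *m b -> g *: a = M *m c ->
    exists e, f *: c - g *: b = e *: p.
  move=> fa ga; apply: ker_alternating.
  by rewrite mulmxBr -!scalemxAr -fa -ga !scalerA mulrC subrr.
have [c12 c12_E] := kos _ _ _ _ f1a f2a; have [c13 c13_E] := kos _ _ _ _ f1a f3a.
have [c23 c23_E] := kos _ _ _ _ f2a f3a.
have /p_faithful c_0 : (f3 * c12 - (c13 * f2 - c23 * f1)) *: p = 0.
  apply/colP=> x; move/colP/(_ x): c12_E; move/colP/(_ x): c13_E.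
  move/colP/(_ x): c23_E; rewrite !mxE; set px := _ * subPf M x => E23 E13 E12.
  transitivity (f3 * (c12 * px) - f2 * (c13 * px) + f1 * (c23 * px)); first by ring.
  by rewrite -E12 -E13 -E23; ring.
(* The cocycle condition [f3 * c12 = c13 * f2 - c23 * f1] puts [c12] in the ideal of [f1] and [f2];
   multiples of [p], which [M] kills, then absorb it. *)
have [|u [v c12_uv]] := @f3_reg c12 (- c23) c13.
  by apply/eqP; rewrite -subr_eq0 -[0]c_0; apply/eqP; ring.
have [w w_E] : exists w, b1 + v *: p = f1 *: w.
  apply: (@f2_scale_dvd _ _ (b2 - u *: p)); apply/eqP; rewrite -subr_eq0; apply/eqP.
  transitivity (c12 *: p - (f1 *: b2 - f2 *: b1)); last by rewrite c12_E subrr.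
  by rewrite c12_uv; apply/colP=> x; rewrite !mxE; ring.
exists w; apply: f1_scale_inj; rewrite f1a scalemxAr -w_E mulmxDr -scalemxAr.
by rewrite mul_signedPf // scaler0 addr0.
Qed.

End BuchsbaumEisenbud.

(** * Minimal homogeneous generators *)

Section Coefficients.
Variables (k : fieldType) (N : nat).
Implicit Types p q f : {mpoly k[N]}.

Lemma mcoeffM_mnm0 p q : (p * q)@_0 = p@_0 * q@_0.
Proof. exact: rmorphM. Qed.

(** A linear coefficient is the constant term of a partial derivative, so this is the Leibniz
    rule. *)
Lemma mcoeffM_mnm1 p q l : (p * q)@_U_(l) = p@_0 * q@_U_(l) + p@_U_(l) * q@_0.
Proof.
have coefU r : r@_U_(l) = (r^`M(l))@_0 by rewrite mcoeff_deriv mnm0E add0m.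
by rewrite !coefU mderivM mcoeffD !mcoeffM_mnm0 addrC.
Qed.

(** The square of the ideal of the variables, described by coefficients. *)
Definition order_ge2 p : Prop := p@_0 = 0 /\ forall l, p@_U_(l) = 0.

Lemma order_ge2_ideal : is_ideal order_ge2.
Proof.
split=> [|p q [p0 p1] [q0 q1]|r p [p0 p1]].
- by split=> *; rewrite mcoeff0.
- by split=> *; rewrite mcoeffD ?p0 ?q0 ?p1 ?q1 addr0.
by split=> *; rewrite ?mcoeffM_mnm0 ?mcoeffM_mnm1 p0 ?p1 !mulr0 ?addr0.
Qed.

Lemma mcoeff0_sumX (q : 'I_N -> {mpoly k[N]}) : (\sum_l q l * 'X_l)@_0 = 0.
Proof.
rewrite raddf_sum big1 //= => l _.
by rewrite mcoeffM_mnm0 mcoeffX -mdeg_eq0 mdeg1 mulr0.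
Qed.

Lemma mcoeff1_sumX (q : 'I_N -> {mpoly k[N]}) j :
  (\sum_l q l * 'X_l)@_U_(j) = (q j)@_0.
Proof.
rewrite raddf_sum (bigD1 j) //= big1 => [|l neq_lj]; last first.
  rewrite mcoeffM_mnm1 !mcoeffX -mdeg_eq0 mdeg1 mulr0 addr0.
  by rewrite eq_mnm1 (negPf neq_lj) mulr0.
by rewrite mcoeffM_mnm1 !mcoeffX -mdeg_eq0 mdeg1 eqxx mulr0 mulr1 !addr0.
Qed.

Lemma mcoeff0_eq0 p :
  p@_0 = 0 -> exists q : 'I_N -> {mpoly k[N]}, p = \sum_l q l * 'X_l.
Proof.
move=> p0; pose J q := generated_by (fun l : 'I_N => 'X_l : {mpoly k[N]}) q.
suff: J p by move/generated_byP.
have [J0 JD JM] : is_ideal J := ideal_span_ideal _.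
rewrite (mpolyE p) big_seq; apply: (big_ind J) => // m m_p.
rewrite -mul_mpolyC; apply: (JM).
have: m != 0%MM by apply: contraTneq m_p => ->; rewrite mcoeff_msupp p0 eqxx.
rewrite -mdeg_eq0 mdegE sum_nat_eq0 negb_forall => /existsP[l m_l].
have /submK<- : (U_(l) <= m)%MM by rewrite lep1mP.
rewrite mpolyXD; apply: (JM).
by apply: mem_ideal_span; exists l.
Qed.

Lemma pihomog0E p : pihomog mdeg 0 p = (p@_0)%:MP.
Proof.
rewrite (mpolyE p) !raddf_sum /=; apply: eq_bigr => m _.
rewrite linearZ /= pihomogX mcoeffZ mcoeffX mdeg_eq0.
case: eqP => [->|_] /=; first by rewrite mpolyX0 mulr1 alg_mpolyC.
by rewrite scaler0 mulr0 mpolyC0.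
Qed.

Lemma pihomogM_homog d e p f : f \is e.-homog ->
  pihomog mdeg d (p * f) = (if (e <= d)%N then pihomog mdeg (d - e) p else 0) * f.
Proof.
move=> hom_f; rewrite (mpolyE p) mulr_suml !raddf_sum /=.
have mono m : pihomog mdeg d (p@_m *: 'X_[m] * f) =
    if mdeg m + e == d then p@_m *: 'X_[m] * f else 0.
  have hom_mf : p@_m *: 'X_[m] * f \is (mdeg m + e).-homog.
    by rewrite dhomogM ?dhomogZ ?dhomogX.
  have [<-|/eqP ne] := eqVneq; first exact: pihomog_dE.
  by apply: pihomog_ne0 hom_mf; apply/eqP.
rewrite (eq_bigr _ (fun m _ => mono m)); case: leqP => [le_ed|lt_de].
  rewrite mulr_suml; apply: eq_bigr => m _; rewrite linearZ /= pihomogX.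
  by rewrite -(eqn_add2r e) subnK //; case: eqP; rewrite ?scaler0 ?mul0r.
rewrite mul0r big1 // => m _; case: eqP => // def_d.
by rewrite -def_d ltnNge leq_addl in lt_de.
Qed.

(** A graded Nakayama argument: in the component of the syzygy in the degree of [f t], the
    coefficient of [f t] is the invertible constant [(c t)@_0]. *)
Lemma homog_generator_redundant (T : finType) (S : {set T})
    (f c : T -> {mpoly k[N]}) t :
  (forall u, f u \is homog mdeg) -> t \in S ->
  \sum_(u in S) c u * f u = 0 -> (c t)@_0 != 0 -> comb (S :\ t) f (f t).
Proof.
move=> hom_f St syz ct_neq0; have /homogP[d hom_ft] := hom_f t.
have [|b b_E] := @fin_all_exists _ _
    (fun u b => pihomog mdeg d (c u * f u) = b * f u).
  by move=> u; have /homogP[e /pihomogM_homog->] := hom_f u; eexists.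
have: pihomog mdeg d (\sum_(u in S) c u * f u) = 0 by rewrite syz raddf0.
rewrite raddf_sum (bigD1 t) //= (pihomogM_homog _ _ hom_ft) leqnn subnn pihomog0E.
rewrite mul_mpolyC (eq_bigr _ (fun u _ => b_E u)) => /eqP.
rewrite addr_eq0 => /eqP ft.
exists (fun u => - ((c t)@_0)^-1 *: b u).
rewrite -[LHS](scalerK ct_neq0) ft scalerN -scaleNr scaler_sumr.
by apply: eq_big => u; rewrite ?inE 1?andbC // scalerAl.
Qed.

(** Generators are discarded as long as some syzygy has a coefficient with nonzero constant term. *)
Lemma minimal_generators (T : finType) (f : T -> {mpoly k[N]}) :
  (forall u, f u \is homog mdeg) ->
  exists S : {set T}, (forall t, comb S f (f t)) /\
    forall c, \sum_(u in S) c u * f u = 0 -> forall t, t \in S -> (c t)@_0 = 0.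
Proof.
move=> hom_f; suff: forall m (S : {set T}), (#|S| <= m)%N ->
    (forall t, comb S f (f t)) -> exists S : {set T}, (forall t, comb S f (f t)) /\
    forall c, \sum_(u in S) c u * f u = 0 -> forall t, t \in S -> (c t)@_0 = 0.
  by move/(_ _ setT (leqnn _)); apply => t; apply: mem_comb; rewrite inE.
elim=> [|m IHm] S le_Sm genS.
  exists S; split=> // c _ t.
  by move: le_Sm; rewrite leqn0 cards_eq0 => /eqP->; rewrite inE.
apply: NNPP => noS; apply: (noS); exists S; split=> // c syz t St.
apply/eqP/negPn/negP=> ct_neq0; apply: noS; apply: (IHm (S :\ t)) => [|u].
  by move: le_Sm; rewrite (cardsD1 t) St.
have [e ->] := genS u; apply: ideal_sum (comb_ideal _ _) _ => v Sv.
have [->|neq_vt] := eqVneq v t.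
  exact: (homog_generator_redundant hom_f St syz).
by apply: mem_comb; rewrite !inE neq_vt.
Qed.

(** If [g] also generates, write [f] as [B] times [g] and [g] as [C] times [f]. Modulo the variables
    the product of [B] and [C] is the identity, so its rank [#|A|] is at most [m]. *)
Lemma mu_is_minimal (T : finType) (A : {set T}) (f : T -> {mpoly k[N]})
    (I : {mpoly k[N]} -> Prop) :
  same_ideal I (comb A f) ->
  (forall c, \sum_(t in A) c t * f t = 0 -> forall t, t \in A -> (c t)@_0 = 0) ->
  mu_is I #|A|.
Proof.
move=> I_E minA; split=> [|m g I_g].
  exists (f \o @enum_val _ (mem A)) => p; apply: (iff_trans (I_E p)); split.
    case=> c ->; apply/generated_byP; exists (c \o @enum_val _ (mem A)).
    by rewrite big_enum_val.
  apply: (ideal_span_min (comb_ideal _ _)) => _ [j ->].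
  exact/mem_comb/enum_valP.
have [t|B B_E] := @fin_all_exists 'I_#|A| _
    (fun t (b : 'I_m -> _) => f (enum_val t) = \sum_j b j * g j).
  by apply/generated_byP/I_g/I_E/mem_comb/enum_valP.
have [j|C C_E] := @fin_all_exists 'I_m _
    (fun j (c : T -> _) => g j = \sum_(t in A) c t * f t).
  by apply/I_E/I_g/mem_ideal_span; exists j.
pose B0 := \matrix_(t, j) (B t j)@_0.
pose C0 := \matrix_(j, t) (C j (@enum_val _ (mem A) t))@_0.
suff BC1 : B0 *m C0 = 1%:M.
  by rewrite -[#|A|](mxrank1 k) -BC1 (leq_trans (mxrankM_maxl _ _)) ?rank_leq_col.
(* [B *m C - 1] sends the column of the [f t] to [0], so its rows are syzygies. *)
apply/matrixP=> t u; rewrite !mxE; apply/eqP; rewrite -subr_eq0; apply/eqP.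
pose e v := \sum_j B t j * C j v - (v == enum_val t)%:R.
transitivity (e (enum_val u))@_0.
  rewrite mcoeffB raddf_sum /= mcoeffMn mcoeff1 eqxx (inj_eq enum_val_inj) eq_sym.
  congr (_ - _).
  by apply: eq_bigr => j _; rewrite !mxE mcoeffM_mnm0.
apply: minA; last exact: enum_valP.
rewrite (eq_bigr (fun v => (\sum_j B t j * C j v) * f v -
  (v == enum_val t)%:R * f v)); last first.
  by move=> v _; rewrite mulrBl.
rewrite sumrB; apply/eqP; rewrite subr_eq0; apply/eqP.
rewrite [RHS](bigD1 (enum_val t)) ?enum_valP //= eqxx mul1r.
rewrite [X in _ = _ + X]big1 => [|v /andP[_ /negPf->]]; last by rewrite mul0r.
rewrite addr0 B_E (eq_bigr (fun v => \sum_j B t j * C j v * f v)); last first.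
  by move=> v _; rewrite mulr_suml.
rewrite exchange_big; apply: eq_bigr => j _; rewrite C_E mulr_sumr.
by apply: eq_bigr => v _; rewrite mulrA.
Qed.

End Coefficients.

(** * The trimmed ideal *)

Section Trimming.
Variables (k : fieldType) (n : nat).
Notation R := {mpoly k[3]}.
Variables (M : 'M[R]_n) (i : 'I_n).
Local Notation F := (subPf M).

Lemma Rplus_mcoeff0 (p : R) : Rplus k p <-> p@_0 = 0.
Proof.
split=> [/generated_byP[q ->]|/mcoeff0_eq0 ?]; first exact: mcoeff0_sumX.
exact/generated_byP.
Qed.

(** By exactness the signed syzygy is [M *m b], so [a i] is up to sign a combination of the entries
    of row [i]. *)
Lemma row_syzygy_order_ge2 I (a : 'I_n -> R) :
  alternating M -> grade_is I 3 -> same_ideal I (generated_by F) ->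
  (forall j, Rgt1 (M i j)) -> \sum_j a j * F j = 0 -> order_ge2 (a i).
Proof.
move=> altM [[s [size_s sI [reg _]]] _] I_F row_i syz.
case: s size_s sI reg => [|f1 [|f2 [|f3 []]]] // _ sI reg.
have f_I f : f \in [:: f1; f2; f3] -> generated_by F f by move=> /sI/I_F.
have f1_reg q : f1 * q = 0 -> q = 0.
  move=> f1q; suff /span_seqP[c ->] : span_seq [::] q by rewrite big_ord0.
  by apply: (reg 0%N isT); rewrite /= f1q;
    case: (ideal_span_ideal (fun p => p \in Nil R)).
have f2_reg q r : f2 * q = r * f1 -> exists u, q = u * f1.
  move=> f2q; suff /span_seqP[c ->] : span_seq [:: f1] q.
    by exists (c ord0); rewrite big_ord1.
  apply: (reg 1%N isT); rewrite /= f2q.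
  by apply/span_seqP; exists (fun=> r); rewrite big_ord1.
have f3_reg q r t : f3 * q = r * f1 + t * f2 -> exists u v, q = u * f1 + v * f2.
  move=> f3q; suff /span_seqP[c ->] : span_seq [:: f1; f2] q.
    by exists (c ord0), (c (lift ord0 ord0)); rewrite big_ord_recl big_ord1.
  apply: (reg 2%N isT); rewrite /= f3q.
  apply/span_seqP; exists (fun j => if j == ord0 then r else t).
  by rewrite big_ord_recl big_ord1.
have [||||b a_E] := @syzygy_signedPf _ _ M altM f1 f2 f3 _ _ _ f1_reg f2_reg f3_reg
    (\col_j ((-1) ^+ j * a j)).
- by apply/I_F/sI; rewrite inE eqxx.
- by apply/I_F/sI; rewrite !inE eqxx orbT.
- by apply/I_F/sI; rewrite !inE eqxx !orbT.
- apply/matrixP=> x y; rewrite !mxE -[RHS]syz; apply: eq_bigr => j _.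
  by rewrite !mxE mulrACA -expr2 sqrr_sign mul1r mulrC.
have -> : a i = (-1) ^+ i * \sum_j b j 0 * M i j.
  have := congr1 (fun A : 'cV_n => (-1) ^+ i * A i 0) a_E.
  rewrite !mxE mulrA -expr2.
  rewrite sqrr_sign mul1r => ->; congr (_ * _).
  by apply: eq_bigr => j _; rewrite mulrC.
have [_ _ OM] := order_ge2_ideal k 3; apply: (OM).
apply: ideal_sum => [|j _]; first exact: order_ge2_ideal.
have coef0 m : (mdeg m <= 1)%N -> (M i j)@_m = 0.
  rewrite leqNgt => lt_m; apply: memN_msupp_eq0.
  by apply: contra lt_m; apply: row_i.
by split=> *; apply: coef0; rewrite ?mdeg0 ?mdeg1.
Qed.

Hypothesis Fi_syzygy : forall a, \sum_j a j * F j = 0 -> order_ge2 (a i).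

Let J p := exists2 a, p = \sum_j a j * F j & (a i)@_0 = 0.

Let J_id : is_ideal J.
Proof.
split=> [|_ _ [a -> a0] [b -> b0]|r _ [a -> a0]].
- by exists (fun=> 0); rewrite ?mcoeff0 // big1 // => j _; rewrite mul0r.
- exists (fun j => a j + b j); last by rewrite mcoeffD a0 b0 addr0.
  by rewrite -big_split /=; apply: eq_bigr => j _; rewrite mulrDl.
exists (fun j => r * a j); last by rewrite mcoeffM_mnm0 a0 mulr0.
by rewrite mulr_sumr; apply: eq_bigr => j _; rewrite mulrA.
Qed.

Lemma trimmed_idealP p :
  trimmed_ideal M i p <-> exists2 a, p = \sum_j a j * F j & (a i)@_0 = 0.
Proof.
split=> [[u [v [u_F v_F ->]]]|[a -> /mcoeff0_eq0[q ai_E]]].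
  have F_J j c : (j == i -> c@_0 = 0) -> J (c * F j).
    move=> c0; exists (fun l => if l == j then c else 0).
      rewrite (bigD1 j) //= eqxx big1 ?addr0 // => l /negPf->.
      by rewrite mul0r.
    by rewrite eq_sym; case: eqP c0 => _; rewrite ?mcoeff0 //; apply.
  have [_ JD _] := J_id; apply: (JD).
    apply: (ideal_span_min J_id) u_F => _ [j neq_ji ->].
    by rewrite -[F j]mul1r; apply: F_J; rewrite (negPf neq_ji).
  apply: (ideal_span_min J_id) v_F => _ [x [y [/Rplus_mcoeff0 x0 y_F ->]]].
  have [c y_E] : comb [set: 'I_1] (fun=> F i : R) y.
    apply: (ideal_span_min (comb_ideal [set: 'I_1] _)) y_F => _ ->.
    by apply: (@mem_comb _ _ [set: 'I_1] (fun=> F i) ord0); rewrite inE.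
  rewrite y_E -mulr_suml mulrA; apply: F_J => _.
  by rewrite mcoeffM_mnm0 x0 mul0r.
exists (\sum_(j | j != i) a j * F j), (a i * F i); split.
- apply: ideal_sum (ideal_span_ideal _) _ => j neq_ji.
  by apply: mem_ideal_span; exists j.
- apply: mem_ideal_span; exists (a i), (F i).
  split=> //; last exact: mem_ideal_span.
  by rewrite Rplus_mcoeff0 ai_E mcoeff0_sumX.
by rewrite (bigD1 i) //= addrC.
Qed.

Lemma trimmed_ideal_ideal : is_ideal (trimmed_ideal M i).
Proof.
have [J0 JD JM] := J_id; split=> [|p q Jp Jq|r p Jp]; apply/trimmed_idealP => //.
  by apply: JD; apply/trimmed_idealP.
by apply: JM; apply/trimmed_idealP.
Qed.

(** Subtracting [c *: F i] from its expression in the trimmed ideal gives a syzygy whose [i]-th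
    constant term is [- c]. *)
Lemma Fi_notin_trimmed (c : k) : trimmed_ideal M i (c *: F i) -> c = 0.
Proof.
case/trimmed_idealP=> a cF a0.
have [|] := @Fi_syzygy (fun j => a j - (j == i)%:R * c%:MP).
  rewrite (eq_bigr (fun j =>
    a j * F j - (if j == i then c *: F j else 0))) => [|j _].
    by rewrite sumrB -cF -big_mkcond big_pred1_eq subrr.
  by rewrite -mul_mpolyC; case: eqP => _ /=; ring.
rewrite eqxx mul1r mcoeffB a0 mcoeffC eqxx mulr1 sub0r => /eqP.
by rewrite oppr_eq0 => /eqP.
Qed.

Variable I : R -> Prop.
Hypothesis I_F : same_ideal I (generated_by F).

Lemma trimmed_type : gorenstein_ideal I -> type_is (trimmed_ideal M i) 2.
Proof.
case=> b [socb indb spanb]; pose s := b ord0.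
have soc_s : socle I s by apply: socb.
have ind_s c : I (c *: s) -> c = 0.
  by move=> Ics; apply: (indb (fun=> c) _ ord0); rewrite big_ord1.
have span_s p : socle I p -> exists c, I (p - c *: s).
  by move=> /spanb[c]; rewrite big_ord1; exists (c ord0).
have [J0 JD JM] := trimmed_ideal_ideal.
have J_I p : trimmed_ideal M i p -> I p.
  by case/trimmed_idealP=> a -> _; apply/I_F/generated_byP; exists a.
have I_id : is_ideal I.
  have [I0 ID IM] := ideal_span_ideal (fun p => exists j, p = F j).
  by split=> *; apply/I_F; [apply: I0 | apply: ID; apply/I_F | apply/IM/I_F].
have soc_Fi : socle (trimmed_ideal M i) (F i).
  move=> a /Rplus_mcoeff0 a0; apply/trimmed_idealP.
  exists (fun j => if j == i then a else 0); rewrite ?eqxx // (bigD1 i) //= eqxx.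
  by rewrite big1 ?addr0 // => j /negPf->; rewrite mul0r.
have Xplus l : Rplus k 'X_l by apply: mem_ideal_span; exists l.
(* A lift to [R] of the Koszul relation between [x_l] and [x_l'] is a syzygy of
   the Pfaffians whose [i]-th entry has linear part determined by the constant
   terms of the coefficients of [F i] in [x_l s] and [x_l' s]. *)
have soc_s_trimmed : socle (trimmed_ideal M i) s.
  have [l|a a_E] := @fin_all_exists 'I_3 _
    (fun l (a : 'I_n -> R) => 'X_l * s = \sum_j a j * F j).
    by apply/generated_byP/I_F/soc_s.
  have a0 l : (a l i)@_0 = 0.
    have [l' neq_ll'] : exists l' : 'I_3, l' != l.
      exists (if l == ord0 then ord_max else ord0).
      by have [->|] := eqVneq l ord0; last rewrite eq_sym.
    (* As [l'] differs from [l], the coefficient of the variable of index [l'] in the [i]-th entry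
       is the constant term of [a l i]. *)
    have [|_ /(_ l')] := @Fi_syzygy (fun j => a l j * 'X_l' - a l' j * 'X_l).
      rewrite (eq_bigr (fun j =>
        'X_l' * (a l j * F j) - 'X_l * (a l' j * F j))) => [|j _]; last by ring.
      by rewrite sumrB -!mulr_sumr -!a_E; ring.
    rewrite mcoeffB !mcoeffM_mnm1 !mcoeffX -!mdeg_eq0 !mdeg1 !eq_mnm1 eqxx.
    by rewrite [l == l']eq_sym (negPf neq_ll') !mulr0 mulr1 !addr0 subr0.
  move=> _ /generated_byP[q ->]; rewrite mulr_suml.
  rewrite (eq_bigr (fun l => q l * ('X_l * s))) => [|l _]; last by rewrite mulrA.
  apply: (big_ind _ J0 JD) => l _; apply: (JM).
  by rewrite a_E; apply/trimmed_idealP; exists (a l).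
exists (fun t => if t == ord0 then F i else s); split.
- by move=> t; case: ifP.
(* Independence: modulo [I] only the multiple of [s] remains, so its coefficient vanishes;
   [Fi_notin_trimmed] handles the other one. *)
- move=> c; rewrite !big_ord_recl big_ord0 /= addr0 => Jc.
  have c1 : c (lift ord0 ord0) = 0.
    apply: ind_s; have [_ ID IM] := I_id.
    rewrite -[_ *: s](addKr (c ord0 *: F i)); apply: (ID); last exact: J_I.
    rewrite -mul_mpolyC -mulNr; apply: (IM); apply/I_F/mem_ideal_span.
    by exists i.
  move: Jc; rewrite c1 scale0r addr0 => /Fi_notin_trimmed c0 t.
  by case: (unliftP ord0 t) => [u|] -> //; rewrite (ord1 u).
(* Spanning: [p] is also in the socle modulo [I], so [p - c *: s] is a combination of Pfaffians;
   removing [(a i)@_0 *: F i] leaves an element of the trimmed ideal. *)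
move=> p soc_p; have [|c /I_F/generated_byP[a a_E]] := span_s p.
  by move=> x /soc_p/J_I.
exists (fun t => if t == ord0 then (a i)@_0 else c).
rewrite !big_ord_recl big_ord0 /= addr0 opprD addrCA a_E; apply/trimmed_idealP.
exists (fun j => a j - (j == i)%:R * ((a i)@_0)%:MP); last first.
  by rewrite eqxx mul1r mcoeffB mcoeffC eqxx mulr1 subrr.
rewrite [RHS](eq_bigr (fun j =>
  a j * F j - (if j == i then (a i)@_0 *: F j else 0))) => [|j _].
  by rewrite sumrB -big_mkcond big_pred1_eq addrC.
by rewrite -mul_mpolyC; case: eqP => _ /=; ring.
Qed.

Lemma trimmed_mu : (forall j, F j \is homog mdeg) ->
  exists m, mu_is I m /\ mu_is (trimmed_ideal M i) (m + 2).
Proof.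
move=> homF; have [S [genS minS]] := minimal_generators homF.
have I_S : same_ideal I (comb S F).
  move=> p; split=> [/I_F/generated_byP[c ->]|].
    by apply: ideal_sum => //; apply: comb_ideal.
  case=> c ->; apply/I_F; apply: ideal_sum; first exact: ideal_span_ideal.
  by move=> j _; apply: mem_ideal_span; exists j.
(* The difference of [F j] and its expression over [S] is a syzygy; this is its [i]-th entry up to
   sign. *)
have coef_i j (e : 'I_n -> R) : F j = \sum_(u in S) e u * F u ->
    order_ge2 ((if i \in S then e i else 0) - (i == j)%:R).
  move=> F_E.
  apply: (@Fi_syzygy (fun u => (if u \in S then e u else 0) - (u == j)%:R)).
  rewrite (eq_bigr (fun u => (if u \in S then e u * F u else 0) -
                             (if u == j then F u else 0))) => [|u _].
    by rewrite sumrB -!big_mkcond -F_E big_pred1_eq subrr.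
  by do 2![case: ifP => _] => /=; ring.
(* Otherwise the [i]-th entry for [F i] would be [-1], whose constant term is nonzero. *)
have iS : i \in S.
  have [e /coef_i] := genS i; case: (i \in S) => // -[].
  by rewrite eqxx sub0r mcoeffN mcoeff1 eqxx => /eqP; rewrite oppr_eq0 oner_eq0.
pose A : {set 'I_3 + 'I_n} := [set t | if t is inr j then j \in S :\ i else true].
pose g (t : 'I_3 + 'I_n) : R := match t with inl l => 'X_l * F i | inr j => F j end.
have sumA (c : _ -> R) : \sum_(t in A) c t * g t =
    \sum_(u in S) (if u == i then \sum_l c (inl l) * 'X_l else c (inr u)) * F u.
  rewrite [RHS](bigD1 i) //= eqxx mulr_suml big_sumType /=; congr (_ + _).
    by apply: eq_big => l; rewrite ?inE // mulrA.
  by apply: eq_big => u; rewrite !inE andbC // => /andP[_ /negPf->].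
exists #|S|; split; first exact: mu_is_minimal I_S minS.
have -> : (#|S| + 2 = #|A|)%N.
  rewrite -sum1_card -[in RHS]sum1_card big_sumType (bigD1 i) //=.
  rewrite [X in _ = (X + _)%N](eq_bigl predT) => [|l]; last by rewrite inE.
  rewrite [X in _ = (X + _)%N]sum1_card card_ord addnAC; congr (_ + _)%N.
  by apply: eq_bigl => u; rewrite !inE andbC.
(* Minimality: a syzygy of [g] is one of the [F u] whose coefficient at [F i] is a combination of
   the variables; its linear part vanishes, so the [c (inl l)] have zero constant term. *)
apply: (@mu_is_minimal _ _ _ _ g) => [p|c]; last first.
  rewrite sumA => syz [l _|u].
    rewrite -(mcoeff1_sumX (c \o inl)).
    have [|_ /(_ l)] := @Fi_syzygy (fun u => if u \in S then
      if u == i then \sum_l c (inl l) * 'X_l else c (inr u) else 0);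
      last by rewrite iS eqxx.
    rewrite -[RHS]syz [RHS]big_mkcond; apply: eq_bigr => u _.
    by case: ifP => _; rewrite ?mul0r.
  by rewrite !inE => /andP[/negPf u_i uS]; have := minS _ syz u uS; rewrite u_i.
split=> [/trimmed_idealP[a -> a0]|[c ->]].
  have [e e_E] := fin_all_exists genS.
  (* Rewriting all [F j] over [S] keeps the coefficient of [F i] in the ideal of the variables:
     [a i] lies there, and so does [e j i] for [j != i]. *)
  have a_i : (\sum_j a j * e j i)@_0 = 0.
    rewrite raddf_sum big1 //= => j _; rewrite mcoeffM_mnm0.
    have [->|neq_ji] := eqVneq j i; first by rewrite a0 mul0r.
    have [] := coef_i j (e j) (e_E j).
    by rewrite iS eq_sym (negPf neq_ji) subr0 => -> _; rewrite mulr0.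
  have [q q_E] := mcoeff0_eq0 a_i.
  exists (fun t => match t with inl l => q l | inr u => \sum_j a j * e j u end).
  rewrite sumA -q_E; transitivity (\sum_(u in S) (\sum_j a j * e j u) * F u).
    rewrite (eq_bigr (fun j => \sum_(u in S) a j * e j u * F u)) => [|j _]; last first.
      by rewrite [in LHS]e_E mulr_sumr; apply: eq_bigr => u _; rewrite mulrA.
    by rewrite exchange_big; apply: eq_bigr => u _; rewrite mulr_suml.
  by apply: eq_bigr => u _; case: eqP => [->|].
rewrite sumA; apply/trimmed_idealP; exists (fun u => if u \in S then
    if u == i then \sum_l c (inl l) * 'X_l else c (inr u) else 0).
  by rewrite big_mkcond; apply: eq_bigr => u _; case: ifP; rewrite ?mul0r.
by rewrite iS eqxx mcoeff0_sumX.
Qed.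

End Trimming.

Theorem proposition6p6 (k : fieldType) (I : {mpoly k[3]} -> Prop)
    (n : nat) (M : 'M[{mpoly k[3]}]_n) (i : 'I_n) :
  homogeneous_ideal I ->
  primary_to (Rplus k) I ->
  ideal_le I (ideal_mul (Rplus k) (Rplus k)) ->
  grade_is I 3 ->
  gorenstein_ideal I ->
  alternating M ->
  (forall j : 'I_n, subPf M j \is homog mdeg) ->
  same_ideal I (generated_by (subPf M)) ->
  (forall j : 'I_n, Rgt1 (M i j)) ->
  (exists m : nat, mu_is I m /\ mu_is (trimmed_ideal M i) (m + 2)) /\
  type_is (trimmed_ideal M i) 2.
Proof.
move=> _ _ _ gradeI gorI altM homM I_M row_i.
have syz a := @row_syzygy_order_ge2 _ _ M i I a altM gradeI I_M row_i.
by split; [apply: trimmed_mu | apply: trimmed_type].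
Qed.
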